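(* Let $f_1,\dots,f_m$ be rankers with click logs $\mathcal{D}_i=(q_i^j,y_i^j,c_i^j)_{j=1}^{n_i}$, where clicks follow the Position-Based Propensity Model with examination probabilities $p_k$, the queries are drawn i.i.d. $q\sim\Pr(Q)$, and the query distribution does not depend on the ranker, i.e. $\Pr(Q\mid f_i)=\Pr(Q)$ for all $i$. Then for all ranks $k\neq k'\in\{1,\dots,M\}$ the weighted click rates $\hat c_k^{k,k'}$ and $\hat c_{k'}^{k,k'}$ satisfy $$\mathbb{E}_{q,c}\big[\hat c_k^{k,k'}\big]=p_k\,r_{k,k'},\qquad \mathbb{E}_{q,c}\big[\hat c_{k'}^{k,k'}\big]=p_{k'}\,r_{k,k'},$$ where $$r_{k,k'}=\mathbb{E}_{q}\Big[\sum_{d\in\Omega(q)}\mathbf{1}_{[(q,d)\in S_{k,k'}]}\,\mathrm{rel}(q,d)\Big].$$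
   Context: Queries: $Q$ is a (countable) set of queries with a probability distribution $\Pr(Q)$. For each $q\in Q$ there is a finite candidate set of documents $\Omega(q)$ and a deterministic relevance function $\mathrm{rel}(q,d)\in\{0,1\}$ for $d\in\Omega(q)$ ($1$ = relevant, $0$ = non-relevant). Rankers: $F=\{f_1,\dots,f_m\}$ is a set of deterministic ranking functions; $f_i(q)$ is a ranking (ordering) of $\Omega(q)$. For a ranking $y$, $\mathrm{rk}(d|y)$ denotes the rank (position, starting at $1$) of document $d$ in $y$. Logs: ranker $f_i$ processed $n_i\ge 1$ queries ($n_i$ fixed, not random). Its log is $\mathcal{D}_i=(q_i^j,y_i^j,c_i^j)_{j=1}^{n_i}$, where $q_i^j$ is the $j$-th query, $y_i^j=f_i(q_i^j)$ is the presented ranking, and $c_i^j(d)\in\{0,1\}$ indicates whether $d\in\Omega(q_i^j)$ was clicked. The condition $\Pr(Q\mid f_i)=\Pr(Q)$ for all $i$, together with i.i.d. sampling, means that all the queries $q_i^j$ (for all $i,j$) are i.i.d. from $\Pr(Q)$. Position-Based Propensity Model (PBM): there are numbers $p_k\in[0,1]$ (examination probabilities), depending only on the position $k$, such that if document $d$ is displayed at position $k$ for query $q$, the probability that it is clicked is $$\Pr(C=1\mid q,d,k)=p_k\,\mathrm{rel}(q,d).$$ Thus, conditionally on $q_i^j=q$, $\Pr(c_i^j(d)=1)=p_{\mathrm{rk}(d|f_i(q))}\,\mathrm{rel}(q,d)$. $M$ is a fixed positive integer (number of top positions). Interventional sets: for $k\neq k'\in\{1,\dots,M\}$, $$S_{k,k'}:=\{(q,d):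 q\in Q,\ d\in\Omega(q),\ \exists f,f'\in F \text{ with } \mathrm{rk}(d|f(q))=k \text{ and } \mathrm{rk}(d|f'(q))=k'\}.$$ Weights: $$w(q,d,k):=\sum_{i=1}^m n_i\,\mathbf{1}[\mathrm{rk}(d|f_i(q))=k].$$ Weighted click rates (with the convention $0/0:=0$): $$\hat c_k^{k,k'}:=\sum_{i=1}^m\sum_{j=1}^{n_i}\sum_{d\in\Omega(q_i^j)}\mathbf{1}_{[(q_i^j,d)\in S_{k,k'}]}\,\mathbf{1}_{[\mathrm{rk}(d|y_i^j)=k]}\,\frac{c_i^j(d)}{w(q_i^j,d,k)},$$ $$\hat c_{k'}^{k,k'}:=\sum_{i=1}^m\sum_{j=1}^{n_i}\sum_{d\in\Omega(q_i^j)}\mathbf{1}_{[(q_i^j,d)\in S_{k,k'}]}\,\mathbf{1}_{[\mathrm{rk}(d|y_i^j)=k']}\,\frac{c_i^j(d)}{w(q_i^j,d,k')}.$$ $\mathbb{E}_{q,c}$ denotes expectation over all logged queries and clicks; $\mathbb{E}_q$ denotes expectation over a single query $q\sim\Pr(Q)$. *)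

(* Defs.v *)
From HB Require Import structures.
From mathcomp Require Export all_boot all_order all_algebra.
From mathcomp Require Export finmap.
From mathcomp Require Export all_classical all_reals all_analysis.

Set Implicit Arguments.
Unset Strict Implicit.
Unset Printing Implicit Defensive.

Import Order.TTheory GRing.Theory Num.Theory.

Local Open Scope classical_set_scope.
Local Open Scope ring_scope.

(* Total on real values: equal to 0 when P B = 0, so it is only meaningful
   under the guard 0 < P B. *)
Definition cond_prob d (T : measurableType d) (R : realType)
    (P : probability T R) (A B : set T) : R :=
  fine (P (A `&` B)) / fine (P B).

Definition mutually_independent d d' (T : measurableType d)
    (T' : measurableType d') (R : realType) (P : probability T R)
    (I : choiceType) (X : I -> {RV P >-> T'}) : Prop :=
  forall (J : {fset I}) (A : I -> set T'),
    (forall i, i \in J -> measurable (A i)) ->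
    P (\bigcap_(i in [set` J]) (X i @^-1` A i)) =
    (\prod_(i <- J) P (X i @^-1` A i))%E.

Definition has_law d d' (T : measurableType d) (T' : measurableType d')
    (R : realType) (P : probability T R) (X : {RV P >-> T'})
    (mu : probability T' R) : Prop :=
  forall A, measurable A -> distribution P X A = mu A.

(* Independence is joint over all the pairs (i, j) with j : 'I_(n i), across i as
   well as within each i. *)
Definition iid_sample d d' (T : measurableType d) (T' : measurableType d')
    (R : realType) (P : probability T R) (mu : probability T' R)
    (m : nat) (n : 'I_m -> nat)
    (X : forall i : 'I_m, 'I_(n i) -> {RV P >-> T'}) : Prop :=
  (forall i j, has_law (X i j) mu) /\
  mutually_independent
    (fun s : {i : 'I_m & 'I_(n i)} => X (tag s) (tagged s)).

Definition is_ranking (Doc : choiceType) (A : {fset Doc}) (y : seq Doc) : Prop :=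
  uniq y /\ y =i A.

(* Positions start at 1; a document absent from y gets rank (size y).+1, so rk
   is only meaningful for documents occurring in y. *)
Definition rk (Doc : eqType) (d : Doc) (y : seq Doc) : nat := (index d y).+1.

Definition interventional_set (Q : Type) (Doc : choiceType)
    (Omega : Q -> {fset Doc}) (m : nat) (f : 'I_m -> Q -> seq Doc)
    (k k' : nat) : set (Q * Doc) :=
  [set qd | qd.2 \in Omega qd.1 /\
     exists i i' : 'I_m, rk qd.2 (f i qd.1) = k /\ rk qd.2 (f i' qd.1) = k'].

Definition weight (Q : Type) (Doc : choiceType) (m : nat) (n : 'I_m -> nat)
    (f : 'I_m -> Q -> seq Doc) (x : Q) (d : Doc) (k : nat) : nat :=
  (\sum_(i < m) n i * (rk d (f i x) == k))%N.

(* Rate at position l computed on the interventional set S_{k,k'}; the rates of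
   interest are l = k and l = k'.  Division by a zero weight gives 0. *)
Definition click_rate (R : realType) (Q : Type) (Doc : choiceType)
    (Omega : Q -> {fset Doc}) (m : nat) (n : 'I_m -> nat)
    (f : 'I_m -> Q -> seq Doc)
    (q : forall i : 'I_m, 'I_(n i) -> Q)
    (y : forall i : 'I_m, 'I_(n i) -> seq Doc)
    (c : forall i : 'I_m, 'I_(n i) -> Doc -> bool)
    (k k' l : nat) : R :=
  \sum_(i < m) \sum_(j < n i) \sum_(d <- Omega (q i j))
     \1_(interventional_set Omega f k k') (q i j, d)
     * (rk d (y i j) == l)%:R
     * ((c i j d)%:R / (weight n f (q i j) d l)%:R).

(* Only the values c t d with d \in Omega (q t) are meaningful. *)
Definition measurable_clicks dT (T : measurableType dT) (Q : Type)
    (Doc : choiceType) (Omega : Q -> {fset Doc})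
    (q : T -> Q) (c : T -> Doc -> bool) : Prop :=
  forall d, measurable [set t | d \in Omega (q t) /\ c t d].

(* Pr(C = 1 | q, d, k) = p_k rel(q, d): the conditioning event is that the
   logged query is x and d is displayed at position k.  Nothing is assumed on
   the joint law of different clicks. *)
Definition position_based_clicks dT (T : measurableType dT) (R : realType)
    (P : probability T R) (Q : Type) (Doc : choiceType)
    (Omega : Q -> {fset Doc}) (relevant : Q -> Doc -> bool) (p : nat -> R)
    (q : T -> Q) (y : T -> seq Doc) (c : T -> Doc -> bool) : Prop :=
  forall (x : Q) (d : Doc) (k : nat), d \in Omega x ->
    let shown := [set t | q t = x /\ rk d (y t) = k] in
    (0 < P shown)%E ->
    cond_prob P [set t | c t d] shown = p k * (relevant x d)%:R.

Definition expected_relevance dQ (Q : measurableType dQ) (R : realType)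
    (PrQ : probability Q R) (Doc : choiceType) (Omega : Q -> {fset Doc})
    (relevant : Q -> Doc -> bool) (m : nat) (f : 'I_m -> Q -> seq Doc)
    (k k' : nat) : \bar R :=
  ('E_PrQ[fun x => (\sum_(d <- Omega x)
      \1_(interventional_set Omega f k k') (x, d) * (relevant x d)%:R)%R])%E.

(* Main.v *)
(* Conditioning on the query q = x turns each click at position l into
   p_l rel(x, d), so a single logged query of ranker f_i contributes
   E_q[sum_d 1_S [rk(d | f_i(q)) = l] p_l rel(q, d) / w(q, d, l)].  Summing over
   the n_i queries of each ranker rebuilds the weight w in the numerator, where
   it cancels: w > 0 on S_{k,k'} because some ranker puts d at position l.  All
   terms are nonnegative, so sums and integrals commute freely. *)
Require Import Defs.
From mathcomp Require Import ring measurable_realfun.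

Set Implicit Arguments.
Unset Strict Implicit.
Unset Printing Implicit Defensive.

Import Order.TTheory GRing.Theory Num.Theory.

Local Open Scope classical_set_scope.
Local Open Scope ring_scope.

(** * Decomposition of a sample space into the fibres of a countable-valued map *)

Section discrete_fibers.
Context d d' (T : measurableType d) (Q : measurableType d').
Hypothesis Q_countable : countable [set: Q].
Hypothesis Q_discrete : forall A : set Q, measurable A.
Variable q : {mfun T >-> Q}.

(** An injection [e] of [Q] into the naturals numbers the fibres: [F n] is the fibre over the point
    coded by [n], and is empty when [n] codes no point. *)
Lemma fibers_exhaust : exists F : (set T)^nat,
  [/\ forall n, measurable (F n), trivIset setT F, \bigcup_n F n = setT &
      forall n, F n = set0 \/ exists x, F n = q @^-1` [set x]].
Proof.
have /countable_injP[e e_inj] := Q_countable.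
have e_injT : injective e by move=> a b; apply: e_inj; rewrite inE.
exists (fun n => q @^-1` (e @^-1` [set n])); split.
- by move=> n; exact: measurable_funPTI.
- by move=> a b _ _ [t [/= <- <-]].
- by apply/seteqP; split => // t _; exists (e (q t)).
- move=> n; have [[x exn]|nx] := pselect (exists x, e x = n).
    right; exists x; apply/seteqP; split => t /= => [|->//].
    by rewrite -exn => /e_injT.
  by left; apply/seteqP; split => t //= etn; apply: nx; exists (q t).
Qed.

Lemma measurable_fun_fibers d1 (T1 : measurableType d1) (g : T -> T1) :
  (forall x, measurable_fun (q @^-1` [set x]) g) -> measurable_fun [set: T] g.
Proof.
move=> mg; have [F [mF _ <- Ffib]] := fibers_exhaust.
apply/measurable_fun_bigcup => // n.
have [->|[x ->]] := Ffib n; [exact: measurable_fun_set0|exact: mg].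
Qed.

(** Countable additivity turns both integrals into series over the fibres, which agree term by term.
    This replaces conditional expectation given [q]. *)
Lemma eq_ge0_integral_fibers (R : realType)
    (mu : {measure set T -> \bar R}) (g h : T -> \bar R) :
  measurable_fun [set: T] g -> measurable_fun [set: T] h ->
  (forall t, 0 <= g t)%E -> (forall t, 0 <= h t)%E ->
  (forall x, \int[mu]_(t in q @^-1` [set x]) g t =
             \int[mu]_(t in q @^-1` [set x]) h t)%E ->
  (\int[mu]_t g t = \int[mu]_t h t)%E.
Proof.
have [F [mF tF <- Ffib]] := fibers_exhaust => mg mh g0 h0 gh.
rewrite !ge0_integral_bigcup//; apply: eq_eseriesr => n _.
by have [->|[x ->]] := Ffib n; rewrite ?integral_set0.
Qed.

End discrete_fibers.

Lemma integral_has_law d d' (T : measurableType d) (T' : measurableType d')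
    (R : realType) (P : probability T R) (X : {RV P >-> T'})
    (mu : probability T' R) (g : T' -> \bar R) :
  has_law X mu -> measurable_fun [set: T'] g -> (forall x, 0 <= g x)%E ->
  (\int[P]_t g (X t) = \int[mu]_x g x)%E.
Proof.
move=> Xmu mg g0.
rewrite -(ge0_integral_distribution X mg g0).
by apply: eq_measure_integral => A mA _; exact: Xmu.
Qed.

(** * Expected clicks of a single logged query *)

Section expected_clicks.
Context (R : realType) dQ (Q : measurableType dQ).
Hypothesis Q_countable : countable [set: Q].
Hypothesis Q_discrete : forall A : set Q, measurable A.
Variables (PrQ : probability Q R) (Doc : choiceType) (Omega : Q -> {fset Doc}).
Context dT (T : measurableType dT) (P : probability T R).
Variables (q : {RV P >-> Q}) (c : T -> Doc -> bool).
Hypothesis q_law : has_law q PrQ.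
Hypothesis c_measurable : measurable_clicks Omega q c.

(** Clicks are cut down to candidate documents because [c_measurable] gives measurability of these
    sets only. *)
Let clicked (d : Doc) := [set t | d \in Omega (q t) /\ c t d].

Let measurable_fiber x : measurable (q @^-1` [set x]).
Proof. exact: measurable_funPTI. Qed.

(** On a fibre the random index set [Omega (q t)] is frozen to [Omega x], which leaves a fixed
    finite sum of measurable indicators. *)
Let sum_clickedE (a : Q -> Doc -> R) x :
  {in q @^-1` [set x],
    (fun t => \sum_(d <- Omega x) a x d * \1_(clicked d) t) =1
    (fun t => \sum_(d <- Omega (q t)) a (q t) d * (c t d)%:R)}.
Proof.
move=> t; rewrite inE => /= qtx; rewrite qtx; apply: eq_big_seq => d dx.
rewrite indicE; congr (_ * _%:R); congr nat_of_bool.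
by apply/idP/idP => [/set_mem[]//|ct]; apply/mem_set; rewrite /clicked/= qtx.
Qed.

Lemma measurable_sum_clicks (a : Q -> Doc -> R) :
  measurable_fun [set: T]
    (fun t => \sum_(d <- Omega (q t)) a (q t) d * (c t d)%:R).
Proof.
apply: (measurable_fun_fibers Q_countable Q_discrete (q := q)) => x.
apply: eq_measurable_fun (sum_clickedE a (x := x)) _.
apply: measurable_sum => d; apply: measurable_funM => //.
by apply: measurable_indic; exact: c_measurable.
Qed.

(** Here [theta x d] is the click probability given [q = x]. It is required only where [a x d] is
    nonzero, since the click model will supply it at the one position that [a] selects. *)
Lemma integral_sum_clicks (a theta : Q -> Doc -> R) :
  (forall x d, 0 <= a x d) -> (forall x d, 0 <= theta x d) ->
  (forall x d, d \in Omega x -> a x d != 0 ->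
    P (q @^-1` [set x] `&` [set t | c t d]) =
    ((theta x d)%:E * P (q @^-1` [set x]))%E) ->
  (\int[P]_t (\sum_(d <- Omega (q t)) a (q t) d * (c t d)%:R)%:E =
   \int[PrQ]_x (\sum_(d <- Omega x) a x d * theta x d)%:E)%E.
Proof.
move=> a0 th0 Pclick.
pose h x : \bar R := (\sum_(d <- Omega x) a x d * theta x d)%:E.
have h0 x : (0 <= h x)%E.
  by rewrite lee_fin; apply: sumr_ge0 => d _; exact: mulr_ge0.
have mh : measurable_fun [set: Q] h by move=> _ B _; exact: Q_discrete.
(* The right side is pulled back along [q], so that both sides are integrals over [P] and can be
   compared fibre by fibre. *)
rewrite -(integral_has_law q_law mh h0).
apply: (eq_ge0_integral_fibers Q_countable Q_discrete (q := q)) => //.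
- by apply/measurable_EFinP; exact: measurable_sum_clicks.
- exact: measurableT_comp.
- by move=> t; rewrite lee_fin; apply: sumr_ge0 => d _; exact: mulr_ge0.
move=> x.
transitivity (\sum_(d <- Omega x)
    \int[P]_(t in q @^-1` [set x]) ((a x d)%:E * (\1_(clicked d) t)%:E))%E.
  rewrite -ge0_integral_sum//.
  - apply: eq_integral => t tx; rewrite -(sum_clickedE a tx) -sumEFin.
    by apply: eq_bigr => d _; rewrite EFinM.
  - move=> d; apply: measurable_funeM; apply/measurable_EFinP.
    by apply: measurable_indic; exact: c_measurable.
  - by move=> d t _; rewrite -EFinM lee_fin mulr_ge0.
transitivity (\int[P]_(t in q @^-1` [set x]) (cst (h x)) t)%E; last first.
  by apply: eq_integral => t /set_mem /= ->.
rewrite integral_cst// /h -sumEFin ge0_sume_distrl; last first.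
  by move=> d _; rewrite lee_fin mulr_ge0.
apply: eq_big_seq => d dx.
rewrite ge0_integralZl_EFin//; last first.
  by apply/measurable_EFinP; apply: measurable_indic; exact: c_measurable.
rewrite integral_indic//; last exact: c_measurable.
(* A zero coefficient is treated apart, as [Pclick] says nothing there. *)
have [->|ax0] := eqVneq (a x d) 0; first by rewrite mul0r !mul0e.
rewrite EFinM -muleA -Pclick//; congr (_ * P _)%E.
apply/seteqP; split => t /=; first by move=> [[_ ct] qx].
by move=> [qx ct]; split=> //; rewrite /clicked /= qx.
Qed.

End expected_clicks.

(** The ranking is a function of the query, so the conditioning event at the position [rk d (g x)]
    is the whole fibre over [x]. The product form, unlike the quotient, also covers fibres of
    probability zero. *)
Lemma position_based_clicks_fiber (R : realType) dQ (Q : measurableType dQ)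
    (Doc : choiceType) (Omega : Q -> {fset Doc}) (relevant : Q -> Doc -> bool)
    dT (T : measurableType dT) (P : probability T R) (q : {RV P >-> Q})
    (g : Q -> seq Doc) (y : T -> seq Doc) (c : T -> Doc -> bool) (p : nat -> R)
    x d :
  (forall A : set Q, measurable A) ->
  measurable_clicks Omega q c -> (forall t, y t = g (q t)) ->
  position_based_clicks P Omega relevant p q y c -> d \in Omega x ->
  P (q @^-1` [set x] `&` [set t | c t d]) =
  ((p (rk d (g x)) * (relevant x d)%:R)%:E * P (q @^-1` [set x]))%E.
Proof.
move=> Q_discrete mc yE pbm dx.
have mx : measurable (q @^-1` [set x]) by exact: measurable_funPTI.
have shownE : [set t | q t = x /\ rk d (y t) = rk d (g x)] = q @^-1` [set x].
  by apply/seteqP; split => t /=; [case|move=> qx; rewrite yE qx].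
(* Since [d] is a candidate for [x], intersecting with the fibre makes the raw click event
   measurable. *)
have clickE : q @^-1` [set x] `&` [set t | c t d] =
    q @^-1` [set x] `&` [set t | d \in Omega (q t) /\ c t d].
  by apply/seteqP; split => t /= [-> h]; [split|case: h].
have mxc : measurable (q @^-1` [set x] `&` [set t | c t d]).
  by rewrite clickE; apply: measurableI => //; exact: mc.
have [Px0|Px0] := eqVneq (P (q @^-1` [set x])) 0%E.
  rewrite Px0 mule0.
  by apply: (subset_measure0 (mu := P) _ mx _ Px0) => // t [].
have := pbm x d (rk d (g x)) dx; rewrite /= shownE lt0e Px0 measure_ge0.
move=> /(_ isT) <-; rewrite /cond_prob [X in fine (P X) / _]setIC.
rewrite -[X in (_ = _ * X)%E]fineK ?fin_num_measure// -EFinM mulfVK.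
  by rewrite fineK ?fin_num_measure.
by rewrite fine_eq0 ?fin_num_measure.
Qed.

(** The summand of ranker [i] alone already contributes [n i]. *)
Lemma weight_gt0 (Q : Type) (Doc : choiceType) m (n : 'I_m -> nat)
    (f : 'I_m -> Q -> seq Doc) x d (i : 'I_m) :
  (forall i, 0 < n i)%N -> (0 < weight n f x d (rk d (f i x)))%N.
Proof.
move=> n_gt0; rewrite /weight (bigD1 i)//= eqxx muln1.
by rewrite addn_gt0 n_gt0.
Qed.

Lemma expected_click_rate (R : realType) (dQ : measure_display)
    (Q : measurableType dQ) (PrQ : probability Q R) (Doc : choiceType)
    (Omega : Q -> {fset Doc}) (relevant : Q -> Doc -> bool)
    (m : nat) (f : 'I_m -> Q -> seq Doc) (n : 'I_m -> nat)
    (dT : measure_display) (T : measurableType dT) (P : probability T R)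
    (q : forall i : 'I_m, 'I_(n i) -> {RV P >-> Q})
    (y : forall i : 'I_m, 'I_(n i) -> T -> seq Doc)
    (c : forall i : 'I_m, 'I_(n i) -> T -> Doc -> bool)
    (p : nat -> R) (k k' l : nat) :
  countable [set: Q] -> (forall A : set Q, measurable A) ->
  (forall i, 0 < n i)%N ->
  (forall i j, has_law (q i j) PrQ) ->
  (forall i j t, y i j t = f i (q i j t)) ->
  (forall i j, measurable_clicks Omega (q i j) (c i j)) ->
  0 <= p l ->
  (forall i j,
     position_based_clicks P Omega relevant p (q i j) (y i j) (c i j)) ->
  l = k \/ l = k' ->
  ('E_P[fun t => click_rate R Omega f (fun i j => q i j t)
    (fun i j => y i j t) (fun i j => c i j t) k k' l] =
   (p l)%:E * expected_relevance PrQ Omega relevant f k k')%E.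
Proof.
move=> Qc Qd n_gt0 q_law yE mc pl0 pbm lkk'.
pose S := interventional_set Omega f k k'.
(* [a] collects all factors of a summand that are determined by the ranker and the query; the click
   is the only other factor. *)
pose a i x d : R :=
  \1_S (x, d) * (rk d (f i x) == l)%:R / (weight n f x d l)%:R.
pose theta x d := p l * (relevant x d)%:R.
have a0 i x d : 0 <= a i x d by rewrite /a !mulr_ge0// invr_ge0.
have theta0 x d : 0 <= theta x d by rewrite /theta mulr_ge0.
have mQ (g : Q -> \bar R) : measurable_fun [set: Q] g.
  by move=> _ B _; exact: Qd.
rewrite /expected_relevance unlock.
transitivity (\sum_(i < m) \sum_(j < n i)
    \int[PrQ]_x (\sum_(d <- Omega x) a i x d * theta x d)%:E)%E.
  under eq_integral do rewrite /click_rate -sumEFin.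
  have mg i (j : 'I_(n i)) : measurable_fun [set: T] (fun t =>
      (\sum_(d <- Omega (q i j t)) a i (q i j t) d * (c i j t d)%:R)%:E).
    by apply/measurable_EFinP; exact: measurable_sum_clicks.
  have termE i (j : 'I_(n i)) t :
      \sum_(d <- Omega (q i j t)) \1_S (q i j t, d)
        * (rk d (y i j t) == l)%:R
        * ((c i j t d)%:R / (weight n f (q i j t) d l)%:R) =
      \sum_(d <- Omega (q i j t)) a i (q i j t) d * (c i j t d)%:R.
    by apply: eq_bigr => d _; rewrite /a yE; ring.
  under eq_integral do under eq_bigr do
    (rewrite -sumEFin; under eq_bigr do rewrite termE).
  have g0 i (j : 'I_(n i)) t : (0 <=
      (\sum_(d <- Omega (q i j t)) a i (q i j t) d * (c i j t d)%:R)%:E)%E.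
    by rewrite lee_fin; apply: sumr_ge0 => d _; rewrite mulr_ge0.
  rewrite ge0_integral_sum//; last 2 first.
  - by move=> i; exact: emeasurable_sum.
  - by move=> i t _; apply: sume_ge0.
  apply: eq_bigr => i _; rewrite ge0_integral_sum//.
  apply: eq_bigr => j _; apply: integral_sum_clicks => // x d dx.
  (* If [d] is not shown at [l], then [a] vanishes; otherwise [l] is the rank for which the fibre
     lemma gives the click probability. *)
  rewrite /a /theta; have [<- _|] := eqVneq (rk d (f i x)) l; last first.
    by rewrite mulr0 mul0r eqxx.
  exact: (position_based_clicks_fiber Qd (mc i j) (yE i j) (pbm i j) dx).
have h0 i x : (0 <= (\sum_(d <- Omega x) a i x d * theta x d)%:E)%E.
  by rewrite lee_fin; apply: sumr_ge0 => d _; rewrite mulr_ge0.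
transitivity (\int[PrQ]_x \sum_(i < m) \sum_(j < n i)
    (\sum_(d <- Omega x) a i x d * theta x d)%:E)%E.
  rewrite ge0_integral_sum//; last by move=> i x _; apply: sume_ge0.
  by apply: eq_bigr => i _; rewrite ge0_integral_sum.
rewrite -ge0_integralZl_EFin//; last first.
  by move=> x _; rewrite lee_fin; apply: sumr_ge0 => d _; rewrite mulr_ge0.
apply: eq_integral => x _.
(* The integrand no longer depends on [j], so the inner sum becomes the factor [n i]. *)
under eq_bigr do rewrite sumEFin sumr_const card_ord.
rewrite sumEFin -EFinM; congr EFin.
under eq_bigr do rewrite -sumrMnl.
rewrite exchange_big mulr_sumr/=; apply: eq_bigr => d _.
have [Sxd|nSxd] := boolP ((x, d) \in S); last first.
  rewrite indicE (negbTE nSxd) mul0r mulr0 big1// => i _.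
  by rewrite /a indicE (negbTE nSxd) !mul0r mul0rn.
(* One of the two rankers witnessing membership in [S] places [d] at [l], so the convention for
   division by zero is not met on [S]. *)
have w0 : (weight n f x d l)%:R != 0 :> R.
  rewrite pnatr_eq0 -lt0n.
  have [_ [i [i' [/= ki ki']]]] := set_mem Sxd.
  by case: lkk' => ->; [rewrite -ki|rewrite -ki']; exact: weight_gt0.
transitivity ((\sum_(i < m) (n i * (rk d (f i x) == l))%:R)
    / (weight n f x d l)%:R * theta x d).
  rewrite !mulr_suml; apply: eq_bigr => i _.
  by rewrite /a indicE Sxd /= mul1r natrM -[LHS]mulr_natl !mulrA.
by rewrite -natr_sum divff// mul1r /theta indicE Sxd mul1r.
Qed.

Theorem proposition1 (R : realType)
  (* queries, with their distribution *)
  (dQ : measure_display) (Q : measurableType dQ)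
  (Q_countable : countable [set: Q])
  (Q_discrete : forall A : set Q, measurable A)
  (PrQ : probability Q R)
  (* candidate documents and relevance *)
  (Doc : choiceType) (Omega : Q -> {fset Doc}) (relevant : Q -> Doc -> bool)
  (* rankers *)
  (m : nat) (f : 'I_m -> Q -> seq Doc)
  (f_ranking : forall i x, is_ranking (Omega x) (f i x))
  (* logs *)
  (n : 'I_m -> nat) (n_gt0 : forall i, (0 < n i)%N)
  (dT : measure_display) (T : measurableType dT) (P : probability T R)
  (q : forall i : 'I_m, 'I_(n i) -> {RV P >-> Q})
  (y : forall i : 'I_m, 'I_(n i) -> T -> seq Doc)
  (c : forall i : 'I_m, 'I_(n i) -> T -> Doc -> bool)
  (q_iid : iid_sample PrQ q)
  (y_shown : forall i j t, y i j t = f i (q i j t))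
  (c_measurable : forall i j, measurable_clicks Omega (q i j) (c i j))
  (* position-based propensity model *)
  (p : nat -> R)
  (p_prob : forall k, (0 < k)%N -> 0 <= p k <= 1)
  (pbm : forall i j,
     position_based_clicks P Omega relevant p (q i j) (y i j) (c i j))
  (M : nat) (M_gt0 : (0 < M)%N)
  (k k' : nat) (k_range : (1 <= k <= M)%N) (k'_range : (1 <= k' <= M)%N)
  (k_neq_k' : k != k') :
  let rate l t := click_rate R Omega f (fun i j => q i j t)
    (fun i j => y i j t) (fun i j => c i j t) k k' l in
  let r := expected_relevance PrQ Omega relevant f k k' in
  (('E_P[rate k] = (p k)%:E * r) /\ ('E_P[rate k'] = (p k')%:E * r))%E.
Proof.
move=> rate r; split; apply: expected_click_rate => //.
- exact: q_iid.1.
(* [p_prob] bounds [p] only at positive positions; the lower end of the range of [k] provides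
   this. *)
- by have /andP[/p_prob/andP[]] := k_range.
- by left.
- exact: q_iid.1.
- by have /andP[/p_prob/andP[]] := k'_range.
- by right.
Qed.
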